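(* Let $S^{OMP}$ be the set of size $k$ selected by Orthogonal Matching Pursuit, and let $\mathrm{OPT}=\max_{S\subseteq V,\,|S|=k}R^2_{Z,S}$. Then $S^{OMP}$ has the following approximation guarantees: $$\begin{aligned}R^2_{Z,S^{OMP}}&\ge\bigl(1-e^{-(\gamma_{S^{OMP},k}\cdot\lambda_{\min}(C,2k))}\bigr)\cdot\mathrm{OPT}\\&\ge\bigl(1-e^{-\lambda_{\min}(C,2k)^2}\bigr)\cdot\mathrm{OPT}\\&\ge\bigl(1-e^{-\lambda_{\min}(C,k)^2}\bigr)\cdot\Theta\Bigl(\bigl(\tfrac12\bigr)^{1/\lambda_{\min}(C,k)}\Bigr)\cdot\mathrm{OPT}.\end{aligned}$$
   Context: Setting: $Z$ and $V=\{X_1,\dots,X_n\}$ are real random variables with mean $0$ and variance $1$, and $k\le n$ is a positive integer. $C=(\mathrm{Cov}(X_i,X_j))_{i,j}$ is the covariance matrix of the $X_i$ and $\mathbf b=(\mathrm{Cov}(Z,X_i))_i$. For $S\subseteq V$ (identified with its index set), $C_S$ is the submatrix of $C$ with rows and columns in $S$ and $\mathbf b_S$ is the restriction of $\mathbf b$ to $S$. It is assumed throughout that the matrices $C_S$ are non-singular. The squared multiple correlation is $R^2_{Z,S}=1-\min_{\alpha}E[(Z-\sum_{i\in S}\alpha_iX_i)^2]=\mathbf b_S^{T}C_S^{-1}\mathbf b_S$ (and $R^2_{Z,\emptyset}=0$). The residual of $Z$ with respect to $S$ is $\mathrm{Res}(Z,S)=Z-\sum_{i\in S}\alpha_iX_i$,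 where $(\alpha_i)_{i\in S}=C_S^{-1}\mathbf b_S$ are the optimal regression coefficients. Submodularity ratio: for $U\subseteq V$ and $k\ge1$, $$\gamma_{U,k}=\min_{L\subseteq U,\ S\subseteq V,\ |S|\le k,\ S\cap L=\emptyset}\frac{\sum_{i\in S}\bigl(R^2_{Z,L\cup\{X_i\}}-R^2_{Z,L}\bigr)}{R^2_{Z,S\cup L}-R^2_{Z,L}},$$ with the convention $0/0=1$. Sparse eigenvalues: $\lambda_{\min}(C,m)=\min_{S:|S|=m}\lambda_{\min}(C_S)$ for $1\le m\le n$, where $\lambda_{\min}(\cdot)$ of a matrix is its smallest eigenvalue; for $m>n$ put $\lambda_{\min}(C,m)=\lambda_{\min}(C)$. Orthogonal Matching Pursuit (OMP): start with $S_0=\emptyset$; in iteration $i+1$ choose a variable $X_m$ maximizing $|\mathrm{Cov}(\mathrm{Res}(Z,S_i),X_m)|$ and set $S_{i+1}=S_i\cup\{X_m\}$; output $S_k$.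
   Formalization: The third line is proved as a lower bound on R² of S^OMP, not on the second line: the literal inequality fails for n=2, k=1, Z=X_1, Corr(X_1,X_2)=1-ε with ε→0, where the second bound tends to 0 and the third stays fixed. *)

(* Defs.v *)
From HB Require Import structures.
From mathcomp Require Export all_boot all_order all_algebra.
From mathcomp Require Export all_classical all_reals all_analysis.
Set Implicit Arguments.
Unset Strict Implicit.
Unset Printing Implicit Defensive.
Import Order.TTheory GRing.Theory Num.Theory.
Import numFieldNormedType.Exports.
Local Open Scope classical_set_scope.
Local Open Scope ring_scope.

(* Throughout, a set of variables S <= V = {X_1, ..., X_n} is a finite set of
   indices S : {set 'I_n}, and its elements are listed by enum_val.  Minima and
   maxima over families of reals are written with inf and sup; they are all
   attained: the families are finite and nonempty, except the one in R2, which
   consists of the values of a quadratic form plus an affine form, bounded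
   below by 0. *)

(** Covariances *)

Definition cov {d} {T : measurableType d} {R : realType} (P : probability T R)
    (Y W : T -> R) : R := fine (covariance P Y W).

Definition cov_mx {d} {T : measurableType d} {R : realType}
    (P : probability T R) (n : nat) (X : 'I_n -> {RV P >-> R}) : 'M[R]_n :=
  \matrix_(i, j) cov P (X i) (X j).

Definition cov_vec {d} {T : measurableType d} {R : realType}
    (P : probability T R) (n : nat) (Z : {RV P >-> R})
    (X : 'I_n -> {RV P >-> R}) : 'cV[R]_n :=
  \col_i cov P Z (X i).

Definition submx_set {R : realType} (n : nat) (C : 'M[R]_n) (S : {set 'I_n}) :
    'M[R]_#|S| :=
  mxsub enum_val enum_val C.

Definition subcv_set {R : realType} (n : nat) (b : 'cV[R]_n) (S : {set 'I_n}) :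
    'cV[R]_#|S| :=
  rowsub enum_val b.

(** Regression *)

(* E[(Z - \sum_(i in S) alpha_i X_i)^2]; only alpha restricted to S matters. *)
Definition mse {d} {T : measurableType d} {R : realType} (P : probability T R)
    (n : nat) (Z : {RV P >-> R}) (X : 'I_n -> {RV P >-> R}) (S : {set 'I_n})
    (alpha : 'I_n -> R) : R :=
  fine 'E_P[fun t => ((Z t - \sum_(i in S) alpha i * X i t) ^+ 2)%R]%E.

(* Squared multiple correlation R^2_{Z,S}, for Z of variance 1. *)
Definition R2 {d} {T : measurableType d} {R : realType} (P : probability T R)
    (n : nat) (Z : {RV P >-> R}) (X : 'I_n -> {RV P >-> R}) (S : {set 'I_n}) :
    R :=
  1 - inf (range (mse Z X S)).

Definition reg_coef {d} {T : measurableType d} {R : realType}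
    (P : probability T R) (n : nat) (Z : {RV P >-> R})
    (X : 'I_n -> {RV P >-> R}) (S : {set 'I_n}) : 'cV[R]_#|S| :=
  invmx (submx_set (cov_mx X) S) *m subcv_set (cov_vec Z X) S.

Definition Res {d} {T : measurableType d} {R : realType} (P : probability T R)
    (n : nat) (Z : {RV P >-> R}) (X : 'I_n -> {RV P >-> R}) (S : {set 'I_n}) :
    T -> R :=
  fun t => Z t - \sum_(j < #|S|) reg_coef Z X S j 0 * X (enum_val j) t.

Definition OPT {d} {T : measurableType d} {R : realType} (P : probability T R)
    (n : nat) (Z : {RV P >-> R}) (X : 'I_n -> {RV P >-> R}) (k : nat) : R :=
  sup [set r | exists2 S : {set 'I_n}, #|S| = k & r = R2 Z X S].

(** Submodularity ratio *)

(* x / y with 0 / 0 = 1.  MathComp's value x / 0 = 0 for x != 0 plays no role in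
   submod_ratio: R2 is nondecreasing in S, so there y = 0 forces x = 0. *)
Definition ratio01 {R : realType} (x y : R) : R :=
  if (x == 0) && (y == 0) then 1 else x / y.

Definition submod_ratio {d} {T : measurableType d} {R : realType}
    (P : probability T R) (n : nat) (Z : {RV P >-> R})
    (X : 'I_n -> {RV P >-> R}) (U : {set 'I_n}) (k : nat) : R :=
  inf [set r | exists L S : {set 'I_n},
    [/\ L \subset U, (#|S| <= k)%N, S :&: L = finset.set0 &
        r = ratio01 (\sum_(i in S) (R2 Z X (i |: L) - R2 Z X L))
                    (R2 Z X (S :|: L) - R2 Z X L)]].

(** Sparse eigenvalues *)

Definition lambda_min {R : realType} (n : nat) (A : 'M[R]_n) : R :=
  inf [set a | eigenvalue A a].

Definition sparse_lambda_min {R : realType} (n : nat) (C : 'M[R]_n) (m : nat) :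
    R :=
  if (m <= n)%N then
    inf [set r | exists2 S : {set 'I_n},
                   #|S| = m & r = lambda_min (submx_set C S)]
  else lambda_min C.

(** Orthogonal Matching Pursuit *)

Definition OMP_step {d} {T : measurableType d} {R : realType}
    (P : probability T R) (n : nat) (Z : {RV P >-> R})
    (X : 'I_n -> {RV P >-> R}) (S S' : {set 'I_n}) : Prop :=
  exists m : 'I_n,
    (forall j : 'I_n,
       `|cov P (Res Z X S) (X j)| <= `|cov P (Res Z X S) (X m)|) /\
    S' = m |: S.

(* A relation rather than a function: ties may be broken arbitrarily. *)
Definition OMP_output {d} {T : measurableType d} {R : realType}
    (P : probability T R) (n : nat) (Z : {RV P >-> R})
    (X : 'I_n -> {RV P >-> R}) (k : nat) (A : {set 'I_n}) : Prop :=
  exists S_ : nat -> {set 'I_n},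
    [/\ S_ 0%N = finset.set0,
        forall i, (i < k)%N -> OMP_step Z X (S_ i) (S_ i.+1) &
        S_ k = A].

(** Order of magnitude *)

(* f = Theta(g), uniformly on D.  There is no absolute value around f, so for
   g > 0 this forces f > 0 on D. *)
Definition Theta_on {R : realType} (D : set R) (f g : R -> R) : Prop :=
  exists c1 c2 : R, [/\ 0 < c1, 0 < c2 &
    forall x, D x -> c1 * g x <= f x /\ f x <= c2 * g x].

(* Main.v *)
(** The variance explained by coefficients [v] is [F v = 2 b.v - v.Cv], and
    [R2 S] is its maximum over the vectors supported on [S].  Writing [g] for
    the covariances of the residual of [S] with the variables, adding [X_i] to
    [S] gains at least [g_i^2] (move by [g_i e_i]), while adding a set [A]
    gains at most [(\sum_(i in A) g_i^2) / lambda] (complete the squares).  This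
    bounds the submodularity ratio from below, and it shows that an OMP step
    closes a fraction [gamma lambda / k] of the distance to the optimum.

    The third bound does not go through the second.  As long as [R2 S] is at
    most a quarter of the optimum [R2 A], testing the residual against the best
    predictor on [A] yields some [g_j^2 >= lambda_k R2 A / (4 k)].  Hence OMP
    reaches [lambda_k / 4] times the optimum, which is more than required with
    [theta x = (1/2)^(1/x) / 4] since [1 - exp (- x^2) <= x^2 <= x]. *)

Require Import Defs.
From mathcomp Require Import ring lra.
Set Implicit Arguments.
Unset Strict Implicit.
Unset Printing Implicit Defensive.
Import Order.TTheory GRing.Theory Num.Theory.
Local Open Scope classical_set_scope.
Local Open Scope ring_scope.

(** * The dot product of column vectors *)

Section Dot.
Context {R : realType}.
Implicit Types m n : nat.

Definition dot n (u v : 'cV[R]_n) : R := (u^T *m v) 0 0.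

Lemma dotE n (u v : 'cV[R]_n) : dot u v = \sum_i u i 0 * v i 0.
Proof. by rewrite /dot mxE; apply: eq_bigr => i _; rewrite mxE. Qed.

Lemma dotC n (u v : 'cV[R]_n) : dot u v = dot v u.
Proof. by rewrite !dotE; apply: eq_bigr => i _; rewrite mulrC. Qed.

Lemma dotDr n (u v w : 'cV[R]_n) : dot u (v + w) = dot u v + dot u w.
Proof. by rewrite /dot mulmxDr mxE. Qed.

Lemma dotDl n (u v w : 'cV[R]_n) : dot (v + w) u = dot v u + dot w u.
Proof. by rewrite dotC dotDr !(dotC u). Qed.

Lemma dotZr n (c : R) (u v : 'cV[R]_n) : dot u (c *: v) = c * dot u v.
Proof. by rewrite /dot -scalemxAr mxE. Qed.

Lemma dotZl n (c : R) (u v : 'cV[R]_n) : dot (c *: u) v = c * dot u v.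
Proof. by rewrite dotC dotZr dotC. Qed.

Lemma dotNr n (u v : 'cV[R]_n) : dot u (- v) = - dot u v.
Proof. by rewrite -scaleN1r dotZr mulN1r. Qed.

Lemma dotBr n (u v w : 'cV[R]_n) : dot u (v - w) = dot u v - dot u w.
Proof. by rewrite dotDr dotNr. Qed.

Lemma dotBl n (u v w : 'cV[R]_n) : dot (v - w) u = dot v u - dot w u.
Proof. by rewrite dotC dotBr !(dotC u). Qed.

Lemma dot_mulmx m n (A : 'M[R]_(m, n)) u v :
  dot (A *m u) v = dot u (A^T *m v).
Proof. by rewrite /dot trmx_mul mulmxA. Qed.

Lemma dotvv n (u : 'cV[R]_n) : dot u u = \sum_i u i 0 ^+ 2.
Proof. by rewrite dotE; apply: eq_bigr => i _; rewrite expr2. Qed.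

Lemma dotvv_ge0 n (u : 'cV[R]_n) : 0 <= dot u u.
Proof. by rewrite dotvv sumr_ge0// => i _; rewrite sqr_ge0. Qed.

Lemma dotvv_gt0 n (u : 'cV[R]_n) : u != 0 -> 0 < dot u u.
Proof.
move=> u0; rewrite lt_neqAle dotvv_ge0 andbT eq_sym; apply: contra u0.
rewrite dotvv psumr_eq0 => [/allP u0|i _]; last exact: sqr_ge0.
apply/eqP/colP => i; rewrite mxE; apply/eqP.
by have := u0 i (mem_index_enum _); rewrite sqrf_eq0.
Qed.

Lemma sqr_le_dotvv n (u : 'cV[R]_n) i : u i 0 ^+ 2 <= dot u u.
Proof.
by rewrite dotvv (bigD1 i)//= lerDl sumr_ge0// => j _; rewrite sqr_ge0.
Qed.

Lemma dot_delta n (u : 'cV[R]_n) i : dot (delta_mx i 0) u = u i 0.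
Proof.
rewrite dotE (bigD1 i)//= big1 ?addr0 => [|j ji]; rewrite mxE !eqxx.
  by rewrite mul1r.
by rewrite (negbTE ji) mul0r.
Qed.

(** Each product [v_i v_j] is at most [v.v] in absolute value. The summand 1 in the witness keeps
    [K] positive when [A = 0]. *)
Lemma quad_form_le n (A : 'M[R]_n) :
  exists2 K, 0 < K & forall v, dot v (A *m v) <= K * dot v v.
Proof.
exists (1 + \sum_i \sum_j `|A i j|).
  by rewrite ltr_pwDl// sumr_ge0// => i _; rewrite sumr_ge0.
move=> v; rewrite mulrDl mul1r -[leLHS]add0r lerD ?dotvv_ge0//.
rewrite dotE mulr_suml ler_sum// => i _.
rewrite mxE mulr_suml mulr_sumr ler_sum// => j _.
have [vi vj] := (sqr_le_dotvv v i, sqr_le_dotvv v j).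
apply: (le_trans (ler_norm _)); rewrite mulrCA normrM ler_wpM2l//.
have ? : 0 <= (v i 0 - v j 0) ^+ 2 by exact: sqr_ge0.
have ? : 0 <= (v i 0 + v j 0) ^+ 2 by exact: sqr_ge0.
by rewrite ler_norml; apply/andP; split; nra.
Qed.

End Dot.

(** * Positive semidefinite matrices and their smallest eigenvalue *)

Section PositiveSemidefinite.
Context {R : realType}.
Implicit Types n : nat.

Definition psd n (A : 'M[R]_n) :=
  A^T = A /\ forall v : 'cV_n, 0 <= dot v (A *m v).

Lemma dot_sym n (A : 'M[R]_n) (u v : 'cV_n) : A^T = A ->
  dot u (A *m v) = dot v (A *m u).
Proof. by move=> sA; rewrite dotC dot_mulmx sA. Qed.

(* Expand [0 <= q (v - s A^-1 v)] for the quadratic form [q] of [A]. *)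
Lemma psd_unit_coercive n (A : 'M[R]_n) : psd A -> A \in unitmx ->
  exists2 e, 0 < e & forall v : 'cV_n, e * dot v v <= dot v (A *m v).
Proof.
move=> [sA pA] uA; have [K K0 HK] := quad_form_le (invmx A).
exists K^-1 => [|v]; first by rewrite invr_gt0.
have := pA (v - K^-1 *: (invmx A *m v)).
rewrite mulmxBr -scalemxAr mulKVmx// dotBr !dotZr !dotBl !dotZl.
rewrite [dot (invmx A *m v) _]dot_sym// mulKVmx// (dotC _ v).
have Ki : 0 < K^-1 by rewrite invr_gt0.
have : K^-1 * dot v (invmx A *m v) <= dot v v by rewrite ler_pdivrMl.
by rewrite -subr_ge0 => /(mulr_ge0 (ltW Ki)); lra.
Qed.

(* The supremum of the [t] with [A - t I] positive semidefinite is an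
   eigenvalue, because [A - t I] is singular there. *)
Lemma psd_rayleigh n (A : 'M[R]_n) : (0 < n)%N -> psd A ->
  exists2 a, eigenvalue A a & forall v : 'cV_n, a * dot v v <= dot v (A *m v).
Proof.
move=> n0 [sA pA].
pose T := [set t : R | forall v : 'cV_n, t * dot v v <= dot v (A *m v)].
have T0 : T 0 by move=> v; rewrite mul0r.
pose i0 := Ordinal n0.
have Tub : ubound T (A i0 i0).
  move=> t /(_ (delta_mx i0 0)).
  by rewrite !dot_delta mxE !eqxx mulr1 -colE mxE.
have supT : has_sup T by split; [exists 0 | exists (A i0 i0)].
have Tsup : T (sup T).
  move=> v; have [->|v0] := eqVneq v 0.
    by rewrite mulmx0 /dot mulmx0 mxE mulr0.
  rewrite -ler_pdivlMr ?dotvv_gt0//; apply: ge_sup; first by exists 0.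
  by move=> t Tt; rewrite ler_pdivlMr ?dotvv_gt0.
exists (sup T) => //.
have BE (v : 'cV_n) :
    dot v ((A - (sup T)%:M) *m v) = dot v (A *m v) - sup T * dot v v.
  by rewrite mulmxBl dotBr mul_scalar_mx dotZr.
have pB : psd (A - (sup T)%:M).
  split; first by rewrite linearB/= sA tr_scalar_mx.
  by move=> v; rewrite BE subr_ge0.
rewrite /eigenvalue /eigenspace kermx_eq0 row_free_unit; apply/negP => uB.
(* If [A - (sup T) I] were invertible, coercivity would put [sup T + e] into [T]. *)
have [e e0 He] := psd_unit_coercive pB uB.
have : sup T + e <= sup T.
  apply: ub_le_sup; first by exists (A i0 i0).
  by move=> v; rewrite mulrDl; have := He v; rewrite BE; lra.
by lra.
Qed.

Lemma inf_ge0 (E : set R) : (forall x, E x -> 0 <= x) -> 0 <= inf E.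
Proof.
(* On the empty set [inf] takes the default value 0. *)
move=> E0; have [->|/set0P En] := eqVneq E set0; first by rewrite inf0.
exact: lb_le_inf.
Qed.

Lemma psd_eigenvalue_ge0 n (A : 'M[R]_n) a : psd A -> eigenvalue A a -> 0 <= a.
Proof.
move=> [sA pA] /eigenvalueP[v vA v0].
(* Eigenvectors are row vectors here; the symmetry of [A] makes [v^T] a column eigenvector. *)
have := pA v^T; have -> : A *m v^T = a *: v^T.
  by rewrite -{1}sA -trmx_mul vA linearZ.
rewrite dotZr pmulr_lge0// dotvv_gt0//.
by apply: contra v0 => /eqP/(congr1 trmx); rewrite trmxK trmx0 => ->.
Qed.

Lemma lambda_min_ge0 n (A : 'M[R]_n) : psd A -> 0 <= lambda_min A.
Proof. by move=> pA; apply: inf_ge0 => a; exact: psd_eigenvalue_ge0. Qed.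

(** Some eigenvalue satisfies the Rayleigh bound by [psd_rayleigh], and [lambda_min A] lies below it
    because the eigenvalues are bounded below by 0. *)
Lemma lambda_min_rayleigh n (A : 'M[R]_n) (v : 'cV_n) : psd A ->
  lambda_min A * dot v v <= dot v (A *m v).
Proof.
case: n A v => [|n] A v pA.
  by rewrite [v]flatmx0 mulmx0 /dot mulmx0 mxE mulr0.
have [a Aa Ha] := psd_rayleigh (ltn0Sn n) pA.
apply: le_trans (Ha v); rewrite ler_wpM2r ?dotvv_ge0//.
apply: ge_inf => //; exists 0 => b; exact: psd_eigenvalue_ge0.
Qed.

End PositiveSemidefinite.

(** * Vectors supported on a set, principal submatrices and sparse eigenvalues *)

Section Restriction.
Context {R : realType}.
Implicit Types n : nat.

Definition supp n (S : {set 'I_n}) (v : 'cV[R]_n) :=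
  forall i, i \notin S -> v i 0 = 0.

Lemma supp_subset n (S S' : {set 'I_n}) (v : 'cV[R]_n) :
  S \subset S' -> supp S v -> supp S' v.
Proof.
by move=> /fintype.subsetP SS' Sv i iS'; apply: Sv; apply: contra iS' => /SS'.
Qed.

Lemma suppD n (S : {set 'I_n}) (u v : 'cV[R]_n) :
  supp S u -> supp S v -> supp S (u + v).
Proof. by move=> Su Sv i iS; rewrite mxE Su// Sv// addr0. Qed.

Lemma suppZ n (S : {set 'I_n}) c (v : 'cV[R]_n) : supp S v -> supp S (c *: v).
Proof. by move=> Sv i iS; rewrite mxE Sv// mulr0. Qed.

Lemma suppB n (S : {set 'I_n}) (u v : 'cV[R]_n) :
  supp S u -> supp S v -> supp S (u - v).
Proof. by move=> Su Sv; rewrite -scaleN1r; apply: suppD => //; exact: suppZ. Qed.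

Lemma supp_delta n (S : {set 'I_n}) i : i \in S -> supp S (delta_mx i 0).
Proof.
move=> iS j jS; rewrite mxE eqxx andbT; case: eqP => // ji.
by rewrite ji iS in jS.
Qed.

Lemma dot_supp n (S : {set 'I_n}) (u v : 'cV[R]_n) : supp S v ->
  dot u v = \sum_(i in S) u i 0 * v i 0.
Proof.
move=> Sv; rewrite dotE [RHS]big_mkcond; apply: eq_bigr => i _.
by case: ifPn => // iS; rewrite Sv// mulr0.
Qed.

(** Extension by zero from coordinates in [S] to all coordinates; its transpose is the restriction
    to [S]. Submatrices thereby become products. *)
Definition incl_mx n (S : {set 'I_n}) : 'M[R]_(n, #|S|) := colsub enum_val 1%:M.

Lemma incl_mxE n (S : {set 'I_n}) i j : incl_mx S i j = (i == enum_val j)%:R.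
Proof. by rewrite !mxE. Qed.

Lemma tr_incl_mulmx n p (S : {set 'I_n}) (A : 'M[R]_(n, p)) :
  (incl_mx S)^T *m A = rowsub enum_val A.
Proof. by rewrite trmx_mxsub trmx1 mul_rowsub_mx mul1mx. Qed.

Lemma mulmx_incl n p (S : {set 'I_n}) (A : 'M[R]_(p, n)) :
  A *m incl_mx S = colsub enum_val A.
Proof. by rewrite mulmx_colsub mulmx1. Qed.

Lemma submx_setE n (C : 'M[R]_n) S :
  submx_set C S = (incl_mx S)^T *m C *m incl_mx S.
Proof. by rewrite mulmx_incl tr_incl_mulmx; apply/matrixP => i j; rewrite !mxE. Qed.

Lemma subcv_setE n (b : 'cV[R]_n) S : subcv_set b S = (incl_mx S)^T *m b.
Proof. by rewrite tr_incl_mulmx. Qed.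

Lemma incl_mx_supp n (S : {set 'I_n}) v : supp S (incl_mx S *m v).
Proof.
move=> i iS; rewrite mxE big1// => j _; rewrite incl_mxE.
by case: eqP => [ij|_]; rewrite ?mul0r//; rewrite ij enum_valP in iS.
Qed.

Lemma incl_mxK n (S : {set 'I_n}) (v : 'cV[R]_n) : supp S v ->
  incl_mx S *m ((incl_mx S)^T *m v) = v.
Proof.
move=> Sv; apply/colP => i; have [iS|iS] := boolP (i \in S); last first.
  by rewrite Sv// incl_mx_supp.
rewrite tr_incl_mulmx mxE (bigD1 (enum_rank_in iS i))//= big1 => [|j ji].
  by rewrite addr0 incl_mxE !mxE enum_rankK_in// eqxx mul1r.
rewrite incl_mxE; case: eqP => [ij|_]; rewrite ?mul0r//.
by case/eqP: ji; apply: enum_val_inj; rewrite enum_rankK_in.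
Qed.

Lemma psd_submx_set n (C : 'M[R]_n) S : psd C -> psd (submx_set C S).
Proof.
move=> [sC pC]; rewrite submx_setE; split => [|v].
  by rewrite !trmx_mul trmxK sC mulmxA.
by rewrite -!mulmxA -dot_mulmx.
Qed.

Lemma lambda_min_submx_rayleigh n (C : 'M[R]_n) S (v : 'cV_n) : psd C ->
  supp S v -> lambda_min (submx_set C S) * dot v v <= dot v (C *m v).
Proof.
move=> pC Sv; set w := (incl_mx S)^T *m v.
have <- : dot w w = dot v v by rewrite /w dot_mulmx trmxK incl_mxK.
have <- : dot w (submx_set C S *m w) = dot v (C *m v).
  by rewrite submx_setE -!mulmxA -dot_mulmx !incl_mxK.
exact/lambda_min_rayleigh/psd_submx_set.
Qed.

Lemma superset_card n m (B : {set 'I_n}) : (#|B| <= m <= n)%N ->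
  exists2 B' : {set 'I_n}, B \subset B' & #|B'| = m.
Proof.
move=> /andP[]; elim: m => [|m IH] Bm mn.
  by exists B => //; apply/eqP; rewrite -leqn0.
move: Bm; rewrite leq_eqVlt => /predU1P[Bm|Bm]; first by exists B.
have [B' BB' B'm] := IH Bm (ltnW mn).
have /fintype.subsetPn[x _ xB'] : ~~ ([set: 'I_n]%SET \subset B').
  by apply/negP => /subset_leq_card; rewrite cardsT card_ord B'm leqNgt mn.
exists (x |: B'); last by rewrite cardsU1 xB' B'm.
exact: fintype.subset_trans (finset.subsetUr _ _).
Qed.

Lemma sparse_lambda_min_ge0 n (C : 'M[R]_n) m : psd C ->
  0 <= sparse_lambda_min C m.
Proof.
move=> pC; rewrite /sparse_lambda_min; case: ifP => _; last exact: lambda_min_ge0.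
by apply: inf_ge0 => _ [S _ ->]; exact/lambda_min_ge0/psd_submx_set.
Qed.

(** A support with fewer than [m] indices is enlarged to one with exactly [m]. For [m > n] the
    sparse eigenvalue is that of [C], whose Rayleigh bound covers every vector. *)
Lemma sparse_rayleigh n (C : 'M[R]_n) m B (v : 'cV_n) : psd C ->
  supp B v -> (#|B| <= m)%N ->
  sparse_lambda_min C m * dot v v <= dot v (C *m v).
Proof.
move=> pC Bv Bm; rewrite /sparse_lambda_min; case: ifPn => mn; last first.
  exact: lambda_min_rayleigh.
have [|B' BB' B'm] := @superset_card n m B; first by rewrite Bm.
apply: le_trans (lambda_min_submx_rayleigh pC (supp_subset BB' Bv)).
rewrite ler_wpM2r ?dotvv_ge0// ge_inf//; last by exists B'.
by exists 0 => _ [S _ ->]; exact/lambda_min_ge0/psd_submx_set.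
Qed.

(** The Rayleigh bound is tested on the basis vector [e_i]. For a unit diagonal this bounds sparse
    eigenvalues by 1. *)
Lemma sparse_lambda_min_le n (C : 'M[R]_n) m i : psd C -> (0 < m)%N ->
  sparse_lambda_min C m <= C i i.
Proof.
move=> pC m0; have := @sparse_rayleigh _ C m [set i]%SET (delta_mx i 0) pC.
rewrite cards1 !dot_delta mxE !eqxx mulr1 -colE mxE; apply => //.
by apply: supp_delta; rewrite finset.set11.
Qed.

End Restriction.

(** * Least squares and the normal equations *)

Section LeastSquares.
Context {R : realType} (n : nat) (C : 'M[R]_n) (b : 'cV[R]_n).
Hypothesis psdC : psd C.
Implicit Types S L : {set 'I_n}.

Definition explained (v : 'cV[R]_n) := 2 * dot b v - dot v (C *m v).

(** The exact second-order expansion at [u]; half the gradient there is [b - C *m u], the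
    covariances of the residual with the variables. *)
Lemma explainedD u v : explained (u + v) =
  explained u + 2 * dot (b - C *m u) v - dot v (C *m v).
Proof.
rewrite /explained dotBl mulmxDr !dotDr !dotDl (dot_sym u v) ?psdC.1//.
by rewrite (dotC (C *m u)); ring.
Qed.

(** The normal equations: the residual of [a] is uncorrelated with the variables in [S]. This form
    characterizes the optimal coefficients without inverting a matrix. *)
Definition normal_eq S a := supp S a /\ forall i, i \in S -> (b - C *m a) i 0 = 0.

Lemma normal_eq_reg S : submx_set C S \in unitmx ->
  normal_eq S (incl_mx S *m (invmx (submx_set C S) *m subcv_set b S)).
Proof.
move=> uS; split=> [|i iS]; first exact: incl_mx_supp.
set a := incl_mx S *m _.
have /colP/(_ (enum_rank_in iS i)) : (incl_mx S)^T *m (b - C *m a) = 0.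
  rewrite mulmxBr -subcv_setE /a !mulmxA -submx_setE -mulmxA mulKVmx//.
  by rewrite subrr.
by rewrite tr_incl_mulmx mxE enum_rankK_in// => ->; rewrite mxE.
Qed.

Lemma normal_eq_dot S a v : normal_eq S a -> supp S v -> dot (b - C *m a) v = 0.
Proof.
by move=> [_ a0] Sv; rewrite (dot_supp _ Sv) big1// => i iS; rewrite a0 ?mul0r.
Qed.

Lemma normal_eq_dotb S a : normal_eq S a -> dot b a = dot a (C *m a).
Proof.
move=> Sa; have := normal_eq_dot Sa Sa.1.
by rewrite dotBl dotC (dotC _ a) => /eqP; rewrite subr_eq0 => /eqP.
Qed.

(** In the expansion at [a] the linear term vanishes by the normal equations, and the quadratic term
    is nonpositive. *)
Lemma explained_max S a v : normal_eq S a -> supp S v -> explained v <= explained a.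
Proof.
move=> Sa Sv; have -> : v = a + (v - a) by rewrite addrC subrK.
rewrite explainedD (normal_eq_dot Sa); last by apply: suppB => //; exact: Sa.1.
by rewrite mulr0 addr0 lerBlDr lerDl psdC.2.
Qed.

End LeastSquares.

(** * Gains from adding variables, and greedy selection *)

Section Selection.
Context {R : realType} (n : nat) (C : 'M[R]_n) (b : 'cV[R]_n).
Hypotheses (psdC : psd C) (diagC : forall i, C i i = 1).
Variable a : {set 'I_n} -> 'cV[R]_n.
Hypothesis aP : forall S, normal_eq C b S (a S).
Implicit Types S L : {set 'I_n}.

(** [r] plays the part of the squared multiple correlation, and [g S] lists the covariances of the
    residual of [S] with all variables. *)
Let r S := explained C b (a S).
Let g S := b - C *m a S.

Lemma gain_mono S S' : S \subset S' -> r S <= r S'.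
Proof. by move=> SS'; apply: explained_max => //; exact: supp_subset (aP S).1. Qed.

Lemma gain_empty : r finset.set0 = 0.
Proof.
rewrite /r /explained; have -> : a finset.set0 = 0.
  by apply/colP => i; rewrite (aP _).1 ?inE// mxE.
by rewrite mulmx0 /dot !mulmx0 mxE mulr0 subr0.
Qed.

Lemma gain_ge0 S : 0 <= r S.
Proof. by rewrite -gain_empty gain_mono// finset.sub0set. Qed.

Lemma gain_dotb S : r S = dot b (a S).
Proof. by rewrite /r /explained -(normal_eq_dotb (aP S)); ring. Qed.

Lemma gain_quad S : r S = dot (a S) (C *m a S).
Proof. by rewrite gain_dotb (normal_eq_dotb (aP S)). Qed.

(** Moving by [t e_i] changes the explained variance by [2 t g_i - t^2], since [C i i = 1]; the
    maximum is at [t = g_i]. *)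
Lemma gain_add_ge S i : g S i 0 ^+ 2 <= r (i |: S) - r S.
Proof.
pose v := a S + g S i 0 *: delta_mx i 0.
have iv : supp (i |: S) v.
  apply: suppD; first by apply: supp_subset (aP S).1; exact: finset.subsetUr.
  by apply/suppZ/supp_delta; rewrite finset.setU11.
have := explained_max psdC (aP _) iv.
rewrite explainedD// -scalemxAr !dotZr dotZl dot_delta -colE [col i C i 0]mxE.
rewrite diagC.
by rewrite dotC dot_delta -/(g S) -/(r S) -/(r (i |: S)); lra.
Qed.

(** With [d] the change of coefficients, [d.Cd >= lam d.d] reduces the claim to
    [2 lam g_i d_i - lam^2 d_i^2 <= g_i^2] for [i] in [S]. Outside [S] the terms are at most 0:
    [g L] vanishes on [L], and [d] vanishes off the union. Keeping [lam] as a factor avoids dividing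
    by it. *)
Lemma gain_le S L m : (#|S :|: L| <= m)%N ->
  sparse_lambda_min C m * (r (S :|: L) - r L) <= \sum_(i in S) g L i 0 ^+ 2.
Proof.
set lam := sparse_lambda_min C m => SLm.
have lam0 : 0 <= lam by exact: sparse_lambda_min_ge0.
pose d := a (S :|: L) - a L.
have sd : supp (S :|: L) d.
  apply: suppB; first exact: (aP _).1.
  by apply: supp_subset (aP L).1; exact: finset.subsetUr.
have -> : r (S :|: L) - r L = 2 * dot (g L) d - dot d (C *m d).
  have -> : r (S :|: L) = explained C b (a L + d) by rewrite /r /d addrC subrK.
  by rewrite explainedD// -/(r L) -/(g L); ring.
have := ler_wpM2l lam0 (sparse_rayleigh psdC sd SLm); rewrite -/lam => h.
have {h} : lam * (2 * dot (g L) d - dot d (C *m d)) <=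
    \sum_i (2 * lam * (g L i 0 * d i 0) - lam ^+ 2 * d i 0 ^+ 2).
  by rewrite sumrB -!mulr_sumr -dotE -dotvv; lra.
move=> /le_trans; apply; rewrite [leRHS]big_mkcond ler_sum// => i _.
case: ifPn => iS.
  have := sqr_ge0 (g L i 0 - lam * d i 0); lra.
have [iL|iL] := boolP (i \in L).
  by rewrite (aP L).2// mul0r mulr0 sub0r oppr_le0 mulr_ge0// sqr_ge0.
by rewrite sd ?expr0n ?mulr0 ?subr0// inE negb_or iS.
Qed.

Definition greedy_step S S' := exists m : 'I_n,
  (forall j, `|(b - C *m a S) j 0| <= `|(b - C *m a S) m 0|) /\ S' = m |: S.

(** The chosen index has the largest [g_j^2], which is at most the gain of the step; there are at
    most [k] terms. *)
Lemma greedy_step_gain S S' (A : {set 'I_n}) k :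
  greedy_step S S' -> (#|A| <= k)%N ->
  \sum_(j in A) g S j 0 ^+ 2 <= k%:R * (r S' - r S).
Proof.
move=> [m [gm ->]] Ak; apply: (@le_trans _ _ (\sum_(j in A) (r (m |: S) - r S))).
  apply: ler_sum => j _; apply: le_trans (gain_add_ge S m).
  rewrite -[leLHS]real_normK ?num_real// -[leRHS]real_normK ?num_real//.
  by rewrite lerXn2r ?nnegrE.
rewrite sumr_const -[leLHS]mulr_natl ler_wpM2r ?ler_nat// subr_ge0.
by rewrite gain_mono// finset.subsetUr.
Qed.

(** * Runs of [k] greedy steps *)

Section Greedy.
Variables (k : nat) (S_ : nat -> {set 'I_n}).
Hypotheses (k0 : (0 < k)%N) (S0 : S_ 0%N = finset.set0).
Hypothesis step : forall i, (i < k)%N -> greedy_step (S_ i) (S_ i.+1).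

(** Only an upper bound, since a step may choose an index already selected. *)
Lemma greedy_card i : (i <= k)%N -> (#|S_ i| <= i)%N.
Proof.
elim: i => [|i IH] ik; first by rewrite S0 cards0.
have [m [_ ->]] := step ik; rewrite cardsU1.
by rewrite (leq_add (leq_b1 _) (IH (ltnW ik))).
Qed.

Lemma greedy_subset i j : (i + j <= k)%N -> S_ i \subset S_ (i + j)%N.
Proof.
elim: j => [|j IH]; first by rewrite addn0.
rewrite addnS => ijk; apply: (fintype.subset_trans (IH (ltnW ijk))).
by have [m [_ ->]] := step ijk; exact: finset.subsetUr.
Qed.

(** Each step shrinks the gap to [r A] by the factor [1 - x] with [x = gamma lam / k], and
    [(1 - x)^k <= exp (- gamma lam)]. *)
Lemma greedy_ratio_bound (A : {set 'I_n}) (gamma : R) : (#|A| <= k)%N ->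
  0 <= gamma <= 1 ->
  (forall L S, L \subset S_ k -> (#|S| <= k)%N -> S :&: L = finset.set0 ->
    gamma * (r (S :|: L) - r L) <= \sum_(i in S) (r (i |: L) - r L)) ->
  (1 - expR (- (gamma * sparse_lambda_min C (2 * k)))) * r A <= r (S_ k).
Proof.
move=> Ak /andP[gamma0 gamma1] gammaP; set lam := sparse_lambda_min C (2 * k).
have lam0 : 0 <= lam by exact: sparse_lambda_min_ge0.
have k0' : 0 < k%:R :> R by rewrite ltr0n.
have k2 : (k <= 2 * k)%N by rewrite mul2n -addnn leq_addr.
(* An index provides the diagonal entry that bounds [lam] by 1; for empty [A] the left side is 0. *)
have [i0 _|A0] := pickP (mem A); last first.
  have -> : A = finset.set0 by apply/setP => i; rewrite inE; exact: A0.
  by rewrite gain_empty mulr0 gain_ge0.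
have lam1 : lam <= 1.
  by rewrite -(diagC i0) sparse_lambda_min_le// (leq_trans k0).
pose x := gamma * lam / k%:R.
have x0 : 0 <= x by rewrite /x divr_ge0// mulr_ge0.
have x1 : x <= 1.
  rewrite /x ler_pdivrMr// mul1r (@le_trans _ _ 1) ?ler1n//.
  by rewrite -[leRHS]mulr1 ler_pM.
have Hi i : (i <= k)%N -> r A - r (S_ i) <= (1 - x) ^+ i * r A.
  elim: i => [|i IH] ik; first by rewrite S0 gain_empty subr0 expr0 mul1r.
  (* The hypothesis on [gamma] concerns disjoint sets, so the selected indices are removed from
     [A]. *)
  pose D := A :\: S_ i.
  have Dk : (#|D| <= k)%N.
    by rewrite (leq_trans _ Ak)// subset_leq_card// finset.subsetDl.
  have DU : D :|: S_ i = A :|: S_ i.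
    by apply/setP => j; rewrite !inE; case: (j \in S_ i); rewrite ?orbT.
  have SiK : S_ i \subset S_ k.
    by have := @greedy_subset i (k - i); rewrite subnKC ?(ltnW ik)//; apply.
  have DI : D :&: S_ i = finset.set0.
    by apply/setP => j; rewrite !inE; case: (j \in S_ i); rewrite ?andbF.
  have h1 := gammaP _ _ SiK Dk DI.
  (* Single additions: [gain_le] with a singleton, where the union has at most [k] elements. *)
  have h2 : lam * \sum_(j in D) (r (j |: S_ i) - r (S_ i)) <=
      \sum_(j in D) g (S_ i) j 0 ^+ 2.
    rewrite mulr_sumr ler_sum// => j jD.
    have := @gain_le [set j]%SET (S_ i) (2 * k).
    rewrite big_set1; apply.
    rewrite cardsU1 (leq_trans _ k2)// (leq_trans _ ik)//.
    by rewrite (leq_add (leq_b1 _) (greedy_card (ltnW ik))).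
  have h3 := greedy_step_gain (step ik) Dk.
  have h4 : r A <= r (D :|: S_ i) by rewrite DU gain_mono// finset.subsetUl.
  have h5 : gamma * lam * (r A - r (S_ i)) <= k%:R * (r (S_ i.+1) - r (S_ i)).
    apply: le_trans h3; apply: le_trans h2.
    rewrite -mulrA mulrCA ler_wpM2l// (le_trans _ h1)// ler_wpM2l//.
    by rewrite lerD2r.
  have h6 : x * (r A - r (S_ i)) <= r (S_ i.+1) - r (S_ i).
    by rewrite /x mulrAC ler_pdivrMr// [leRHS]mulrC.
  have x1' : 0 <= 1 - x by rewrite subr_ge0.
  have := ler_wpM2l x1' (IH (ltnW ik)).
  by rewrite exprS -mulrA; lra.
have := Hi k (leqnn k).
have : (1 - x) ^+ k <= expR (- (gamma * lam)).
  have -> : - (gamma * lam) = - x * k%:R by rewrite /x mulNr divfK ?gt_eqF.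
  rewrite expRM_natr lerXn2r ?nnegrE ?subr_ge0 ?expR_ge0//.
  exact: expR_ge1Dx.
by move=> /(ler_wpM2r (gain_ge0 A)); lra.
Qed.

(* Testing the residual against the optimal predictor [a A] involves only the
   conditioning of [C] on [A], not on the union of [A] with the selected set. *)
Lemma greedy_step_progress S S' (A : {set 'I_n}) m :
  greedy_step S S' -> (#|A| <= m)%N -> (#|A| <= k)%N -> r S <= 4^-1 * r A ->
  sparse_lambda_min C m * r A <= 4 * k%:R * (r S' - r S).
Proof.
move=> SS' Am Ak SA; set lam := sparse_lambda_min C m.
have lam0 : 0 <= lam by exact: sparse_lambda_min_ge0.
have h1 := greedy_step_gain SS' Ak.
(* Expanding the quadratic form at [a S - a A / 2] gives [a S . C (a A) <= r S + r A / 4 <= r A /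
   2], while [b . a A = r A]. *)
have h2 : 2^-1 * r A <= dot (g S) (a A).
  have := psdC.2 (a S - 2^-1 *: a A).
  rewrite mulmxBr -scalemxAr !dotBr !dotBl !dotZr !dotZl -!gain_quad.
  rewrite (dot_sym (a S) (a A) psdC.1) -gain_dotb (dotC (C *m _)).
  by lra.
have h3 := sparse_rayleigh psdC (aP A).1 Am; rewrite -/lam -gain_quad in h3.
(* The weights are chosen so that, by [h3], the last term is at most [lam * r A / 2], which the left
   side absorbs. *)
have h4 : 2 * lam * dot (g S) (a A) <=
    2 * \sum_(j in A) g S j 0 ^+ 2 + 2^-1 * lam ^+ 2 * dot (a A) (a A).
  rewrite (dot_supp _ (aP A).1) (dot_supp _ (aP A).1) !mulr_sumr -big_split/=.
  apply: ler_sum => j _.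
  by have := sqr_ge0 (2 * g S j 0 - lam * a A j 0); lra.
have := ler_wpM2l lam0 h3; have := ler_wpM2l lam0 h2.
by lra.
Qed.

(** By induction, [i] steps reach the fraction [i / k] of the target [lam * r A / 4]. *)
Lemma greedy_quarter_bound (A : {set 'I_n}) : #|A| = k ->
  4^-1 * sparse_lambda_min C k * r A <= r (S_ k).
Proof.
move=> Ak; set lam := sparse_lambda_min C k.
have lam0 : 0 <= lam by exact: sparse_lambda_min_ge0.
have k0' : 0 < k%:R :> R by rewrite ltr0n.
have [i0 _] : {i0 | i0 \in A} by apply/sigW/card_gt0P; rewrite Ak.
have lam1 : lam <= 1 by rewrite -(diagC i0) sparse_lambda_min_le.
have rA := gain_ge0 A.
have Hi i : (i <= k)%N -> i%:R / k%:R * (4^-1 * lam * r A) <= r (S_ i).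
  elim: i => [|i IH] ik; first by rewrite !mul0r gain_ge0.
  (* Once [r] exceeds [r A / 4] the target is already met, because [lam <= 1]; before that, each
     step gains at least [1 / k] of it. *)
  have [SA|/ltW SA] := leP (r (S_ i)) (4^-1 * r A); last first.
    have : r (S_ i) <= r (S_ i.+1).
      by rewrite gain_mono//; have [m [_ ->]] := step ik; exact: finset.subsetUr.
    apply: le_trans; apply: le_trans SA.
    rewrite -[leRHS]mul1r ler_pM ?divr_ge0 ?mulr_ge0 ?invr_ge0//.
      by rewrite ler_pdivrMr// mul1r ler_nat.
    by rewrite ler_wpM2r// -[leRHS]mulr1 ler_wpM2l// invr_ge0.
  have h := greedy_step_progress (step ik) (eq_leq Ak) (eq_leq Ak) SA.
  rewrite -/lam in h.
  have {}h : k%:R^-1 * (4^-1 * lam * r A) <= r (S_ i.+1) - r (S_ i).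
    by rewrite ler_pdivrMl//; lra.
  have := IH (ltnW ik); rewrite -(natr1 i) mulrDl mul1r mulrDl; lra.
by have := Hi k (leqnn k); rewrite divff ?gt_eqF// mul1r.
Qed.

End Greedy.
End Selection.

(** * The submodularity ratio of a monotone set function *)

Section Ratio.
Context {R : realType} (n : nat) (f : {set 'I_n} -> R).
Implicit Types S L : {set 'I_n}.
Hypothesis f_mono : forall S S' : {set 'I_n}, S \subset S' -> f S <= f S'.
Variables (U : {set 'I_n}) (k : nat).

Let ratios := [set x : R | exists L S : {set 'I_n},
  [/\ L \subset U, (#|S| <= k)%N, S :&: L = finset.set0 &
    x = ratio01 (\sum_(i in S) (f (i |: L) - f L)) (f (S :|: L) - f L)]].

Lemma increment_ge0 L S : 0 <= f (S :|: L) - f L.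
Proof. by rewrite subr_ge0 f_mono// finset.subsetUr. Qed.

Lemma increments_ge0 L S : 0 <= \sum_(i in S) (f (i |: L) - f L).
Proof. by apply: sumr_ge0 => i _; exact: increment_ge0. Qed.

(** By monotonicity each single increment lies between 0 and the joint one. Hence a zero denominator
    occurs only as [0 / 0]. *)
Lemma increments_eq0 L S : f (S :|: L) - f L = 0 ->
  \sum_(i in S) (f (i |: L) - f L) = 0.
Proof.
move=> y0; apply: big1 => i iS; apply/eqP; rewrite eq_le increment_ge0 andbT.
by rewrite -y0 lerD2r f_mono// finset.setSU// finset.sub1set.
Qed.

Lemma ratios_ge0 x : ratios x -> 0 <= x.
Proof.
move=> [L [S [_ _ _ ->]]]; rewrite /ratio01; case: ifP => // _.
by rewrite divr_ge0 ?increments_ge0 ?increment_ge0.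
Qed.

Lemma ratios1 : ratios 1.
Proof.
exists finset.set0, finset.set0; split; rewrite ?finset.sub0set ?cards0 ?finset.setI0//.
by rewrite finset.setU0 subrr big_set0 /ratio01 eqxx.
Qed.

Lemma inf_ratios_le1 : inf ratios <= 1.
Proof. by apply: ge_inf; [exists 0; exact: ratios_ge0|exact: ratios1]. Qed.

Lemma inf_ratios_mul_le L S : L \subset U -> (#|S| <= k)%N ->
  S :&: L = finset.set0 ->
  inf ratios * (f (S :|: L) - f L) <= \sum_(i in S) (f (i |: L) - f L).
Proof.
move=> LU Sk SL; have [y0|y0] := eqVneq (f (S :|: L) - f L) 0.
  by rewrite y0 mulr0 increments_ge0.
rewrite -ler_pdivlMr ?lt_neqAle 1?eq_sym ?y0 ?increment_ge0//.
apply: ge_inf; first by exists 0; exact: ratios_ge0.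
by exists L, S; split=> //; rewrite /ratio01 (negbTE y0) andbF.
Qed.

(** The condition [lam <= 1] handles the ratios [0 / 0 = 1]; the others follow by division. *)
Lemma le_inf_ratios lam : lam <= 1 ->
  (forall L S, L \subset U -> (#|S| <= k)%N ->
    lam * (f (S :|: L) - f L) <= \sum_(i in S) (f (i |: L) - f L)) ->
  lam <= inf ratios.
Proof.
move=> lam1 H; apply: lb_le_inf; first by exists 1; exact: ratios1.
move=> _ [L [S [LU Sk _ ->]]]; rewrite /ratio01.
have [y0|y0] := eqVneq (f (S :|: L) - f L) 0.
  by rewrite increments_eq0// eqxx.
by rewrite andbF ler_pdivlMr ?H// lt_neqAle eq_sym y0 increment_ge0.
Qed.

End Ratio.

(** * The inner product of square-integrable functions *)

Section SquareIntegrable.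
Context {d} {T : measurableType d} {R : realType} (P : probability T R).
Implicit Types f g h : T -> R.

Definition inner f g : R := fine 'E_P[f \* g]%E.

Lemma innerC f g : inner f g = inner g f.
Proof. by congr (fine (expectation _ _)); apply/funext => t; exact: mulrC. Qed.

Lemma innerDl f g h : f \in Lfun P 2%:E -> g \in Lfun P 2%:E ->
  h \in Lfun P 2%:E -> inner (f \+ g) h = inner f h + inner g h.
Proof.
move=> f2 g2 h2; rewrite /inner -fineD ?expectation_fin_num ?Lfun2_mul_Lfun1//.
rewrite -expectationD ?Lfun2_mul_Lfun1//; congr (fine (expectation _ _)).
by apply/funext => t; exact: mulrDl.
Qed.

Lemma innerZl c f h : f \in Lfun P 2%:E -> h \in Lfun P 2%:E ->
  inner (c \o* f) h = c * inner f h.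
Proof.
move=> f2 h2; have fh := Lfun2_mul_Lfun1 f2 h2.
rewrite /inner -[c in RHS]/(fine c%:E) -fineM ?expectation_fin_num//.
rewrite -expectationZl//; congr (fine (expectation _ _)).
by apply/funext => t /=; rewrite mulrAC.
Qed.

Lemma Lfun2_sub f g : f \in Lfun P 2%:E -> g \in Lfun P 2%:E ->
  f \- g \in Lfun P 2%:E.
Proof. by move=> f2 g2; rewrite rpredB ?lee1n. Qed.

Lemma innerBl f g h : f \in Lfun P 2%:E -> g \in Lfun P 2%:E ->
  h \in Lfun P 2%:E -> inner (f \- g) h = inner f h - inner g h.
Proof.
move=> f2 g2 h2; have fg2 := Lfun2_sub f2 g2.
apply/eqP; rewrite -subr_eq opprK -innerDl//; apply/eqP; congr (inner _ _).
by apply/funext => t /=; rewrite subrK.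
Qed.

Section LinearCombination.
Context {I : Type} (c : I -> R) (X : I -> T -> R).
Hypothesis X2 : forall i, X i \in Lfun P 2%:E.

Lemma Lfun2_lincomb (s : seq I) :
  (fun t => \sum_(i <- s) c i * X i t) \in Lfun P 2%:E.
Proof.
elim: s => [|i s IH].
  by under eq_fun do rewrite big_nil; exact: (Lfun_cst P 0 2).
have iX : c i \o* X i \in Lfun P 2%:E by rewrite Lfun_scale// ler1n.
rewrite (_ : (fun t => _) =
    (c i \o* X i) \+ (fun t => \sum_(i <- s) c i * X i t)).
  by rewrite rpredD ?lee1n.
by apply/funext => t /=; rewrite big_cons [X in X + _]mulrC.
Qed.

Lemma inner_lincomb (s : seq I) h : h \in Lfun P 2%:E ->
  inner (fun t => \sum_(i <- s) c i * X i t) h = \sum_(i <- s) c i * inner (X i) h.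
Proof.
move=> h2; elim: s => [|i s IH].
  rewrite big_nil /inner; transitivity (fine 'E_P[cst 0%R]%E).
    by congr (fine (expectation _ _)); apply/funext => t /=; rewrite big_nil mul0r.
  by rewrite expectation_cst.
rewrite big_cons -IH -innerZl// -innerDl//; first last.
- exact: Lfun2_lincomb.
- by rewrite Lfun_scale// ler1n.
by congr (inner _ _); apply/funext => t /=; rewrite big_cons [X in X + _]mulrC.
Qed.

End LinearCombination.

(** For centred [f] the variance is [E[f^2]], so its finite value 1 gives both square integrability
    and the norm. *)
Lemma Lfun2_variance1 f : measurable_fun setT f ->
  ('E_P[f] = 0)%E -> ('V_P[f] = 1)%E -> f \in Lfun P 2%:E /\ inner f f = 1.
Proof.
move=> mf Ef Vf.
have ff1 : ('E_P[f \* f] = 1)%E.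
  rewrite -Vf /variance [in RHS]unlock Ef/=; congr (expectation _ _).
  by apply/funext => t; rewrite !fctE /= subr0.
split; last by rewrite /inner ff1.
apply/andP; split; rewrite !inE//=.
rewrite /finite_norm unlock; apply: poweR_lty.
suff -> : (\int[P]_x `|(EFin \o f) x| `^ 2 = 'E_P[f \* f])%E by rewrite ff1 ltry.
rewrite [in RHS]unlock; apply: eq_integral => t _ /=.
by rewrite powR_mulrn// real_normK ?num_real// expr2.
Qed.

End SquareIntegrable.

(** * From random variables to the covariance matrix *)

Section Regression.
Context {d} {T : measurableType d} {R : realType} (P : probability T R).
Context (n : nat) (Z : {RV P >-> R}) (X : 'I_n -> {RV P >-> R}).
Hypotheses (EZ : ('E_P[Z] = 0)%E) (VZ : ('V_P[Z] = 1)%E).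
Hypotheses (EX : forall i, ('E_P[X i] = 0)%E) (VX : forall i, ('V_P[X i] = 1)%E).

Let C := cov_mx X.
Let b := cov_vec Z X.

Lemma Z_Lfun2 : (Z : T -> R) \in Lfun P 2%:E.
Proof. by have [] := Lfun2_variance1 (measurable_funPT Z) EZ VZ. Qed.

Lemma X_Lfun2 i : (X i : T -> R) \in Lfun P 2%:E.
Proof. by have [] := Lfun2_variance1 (measurable_funPT (X i)) (EX i) (VX i). Qed.

(** In [E[fg] - E[f] E[g]] the second term vanishes with [E[g]]; [f] may thus be a residual. *)
Lemma cov_centered f g : f \in Lfun P 2%:E -> g \in Lfun P 2%:E ->
  ('E_P[g] = 0)%E -> cov P f g = inner P f g.
Proof.
move=> f2 g2 g0; have P1 : P [set: T] \is a fin_num by exact: fin_num_measure.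
rewrite /cov covarianceE ?Lfun2_mul_Lfun1 ?(Lfun_subset12 P1)//.
by rewrite g0 mule0 sube0.
Qed.

Lemma cov_mxE i j : C i j = inner P (X i) (X j).
Proof. by rewrite mxE cov_centered ?X_Lfun2. Qed.

Lemma cov_vecE i : b i 0 = inner P Z (X i).
Proof. by rewrite mxE cov_centered ?X_Lfun2 ?Z_Lfun2. Qed.

Lemma diag_cov_mx i : C i i = 1.
Proof.
by rewrite cov_mxE; have [] := Lfun2_variance1 (measurable_funPT (X i)) (EX i) (VX i).
Qed.

Let comb (v : 'cV[R]_n) : T -> R := fun t => \sum_i v i 0 * X i t.

Lemma comb_Lfun2 v : comb v \in Lfun P 2%:E.
Proof. by apply: Lfun2_lincomb => i; exact: X_Lfun2. Qed.

Lemma inner_comb_X v j : inner P (comb v) (X j) = (C *m v) j 0.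
Proof.
rewrite inner_lincomb ?X_Lfun2//; last by move=> i; exact: X_Lfun2.
by rewrite mxE; apply: eq_bigr => i _; rewrite cov_mxE innerC mulrC.
Qed.

Lemma inner_comb v : inner P (comb v) (comb v) = dot v (C *m v).
Proof.
rewrite [LHS]inner_lincomb ?comb_Lfun2//; last by move=> i; exact: X_Lfun2.
by rewrite dotE; apply: eq_bigr => i _; rewrite innerC inner_comb_X.
Qed.

Lemma inner_Z_comb v : inner P Z (comb v) = dot b v.
Proof.
rewrite innerC [LHS]inner_lincomb ?Z_Lfun2//; last by move=> i; exact: X_Lfun2.
by rewrite dotC dotE; apply: eq_bigr => i _; rewrite innerC cov_vecE.
Qed.

Lemma inner_ge0 f : 0 <= inner P f f.
Proof. by apply/fine_ge0/expectation_ge0 => t /=; rewrite -expr2 sqr_ge0. Qed.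

Lemma psd_cov_mx : psd C.
Proof.
split=> [|v]; last by rewrite -inner_comb inner_ge0.
by apply/matrixP => i j; rewrite mxE !cov_mxE innerC.
Qed.

(** The bridge to linear algebra: expand the square and use [E[Z^2] = 1]. *)
Lemma inner_residual v :
  inner P (Z \- comb v) (Z \- comb v) = 1 - explained C b v.
Proof.
have [Z2 v2] := (Z_Lfun2, comb_Lfun2 v); have r2 := Lfun2_sub Z2 v2.
rewrite innerBl// ![inner P _ (_ \- _)]innerC !innerBl// inner_comb inner_Z_comb.
rewrite (innerC _ (comb v)) inner_Z_comb.
by rewrite (Lfun2_variance1 (measurable_funPT Z) EZ VZ).2 /explained; ring.
Qed.

Lemma mseE S alpha :
  mse Z X S alpha = 1 - explained C b (\col_i if i \in S then alpha i else 0).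
Proof.
rewrite -inner_residual; congr (fine (expectation _ _)); apply/funext => t /=.
rewrite expr2 /comb.
under [in RHS]eq_bigr do rewrite mxE (fun_if ( *%R^~ _)) mul0r.
by rewrite -big_mkcond.
Qed.

(** The infimum is attained at the coefficients [a], since [explained_max] bounds every other
    choice. *)
Lemma R2E S a : normal_eq C b S a -> R2 Z X S = explained C b a.
Proof.
move=> Sa; rewrite /R2.
suff -> : inf (range (mse Z X S)) = 1 - explained C b a by ring.
have aE : mse Z X S (fun i => a i 0) = 1 - explained C b a.
  rewrite mseE; congr (1 - explained C b _).
  by apply/colP => i; rewrite mxE; case: ifPn => // /Sa.1.
have lb : lbound (range (mse Z X S)) (1 - explained C b a).
  move=> _ [alpha _ <-]; rewrite mseE lerD2l lerN2.
  by apply: (explained_max psd_cov_mx Sa) => i iS; rewrite mxE (negbTE iS).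
apply/eqP; rewrite eq_le; apply/andP; split.
  by rewrite -aE; apply: ge_inf; [exists (1 - explained C b a)|exists (fun i => a i 0)].
by apply: lb_le_inf => //; exists (mse Z X S (fun=> 0)); exists (fun=> 0).
Qed.

(** With its coefficients extended by zero, the residual is [Z] minus a linear combination of all
    variables. This turns OMP steps into [greedy_step]. *)
Lemma cov_Res S j :
  cov P (Res Z X S) (X j) = (b - C *m (incl_mx S *m reg_coef Z X S)) j 0.
Proof.
have -> : Res Z X S = Z \- comb (incl_mx S *m reg_coef Z X S).
  apply/funext => t /=; congr (_ - _); rewrite /comb.
  under [RHS]eq_bigr do rewrite mxE mulr_suml.
  rewrite exchange_big/=; apply: eq_bigr => k _.
  rewrite (bigD1 (enum_val k))//= big1 ?addr0 => [|i ik].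
    by rewrite incl_mxE eqxx mul1r.
  by rewrite incl_mxE (negbTE ik) !mul0r.
set v := incl_mx S *m _.
have [Z2 v2] := (Z_Lfun2, comb_Lfun2 v).
rewrite cov_centered ?X_Lfun2 ?Lfun2_sub// innerBl ?X_Lfun2//.
rewrite inner_comb_X -cov_vecE.
by rewrite [RHS]mxE [X in _ = _ + X]mxE.
Qed.

End Regression.

(** * The optimum and the approximation guarantees *)

Lemma OPT_attained {d} {T : measurableType d} {R : realType}
    (P : probability T R) (n k : nat) (Z : {RV P >-> R})
    (X : 'I_n -> {RV P >-> R}) : (k <= n)%N ->
  exists2 A : {set 'I_n}, #|A| = k & OPT Z X k = R2 Z X A.
Proof.
move=> kn; have [|S0 _ S0k] := @superset_card n k finset.set0.
  by rewrite cards0.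
case: (@arg_maxP _ _ _ S0 (fun S : {set 'I_n} => #|S| == k) (R2 Z X)).
  by rewrite S0k.
move=> A /eqP Ak Amax; exists A => //.
have ub : ubound [set r | exists2 S : {set 'I_n}, #|S| = k & r = R2 Z X S] (R2 Z X A).
  by move=> _ [S Sk ->]; apply: Amax; apply/eqP.
apply/eqP; rewrite eq_le; apply/andP; split.
  by apply: ge_sup => //; exists (R2 Z X A), A.
by apply: ub_le_sup; [exists (R2 Z X A)|exists A].
Qed.

Lemma one_sub_expRN_le {R : realType} (x : R) : 1 - expR (- x) <= x.
Proof. by have := expR_ge1Dx (- x); lra. Qed.

Theorem theorem3p7 (R : realType) :
  exists2 theta : R -> R,
    Theta_on [set x : R | 0 < x <= 1] theta (fun x => (2^-1) `^ (x^-1)) &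
    forall (d : measure_display) (T : measurableType d) (P : probability T R)
      (n k : nat) (Z : {RV P >-> R}) (X : 'I_n -> {RV P >-> R})
      (SOMP : {set 'I_n}),
      (0 < k <= n)%N ->
      ('E_P[Z] = 0)%E -> ('V_P[Z] = 1)%E ->
      (forall i, 'E_P[X i] = 0)%E -> (forall i, 'V_P[X i] = 1)%E ->
      (forall S : {set 'I_n}, submx_set (cov_mx X) S \in unitmx) ->
      OMP_output Z X k SOMP -> #|SOMP| = k ->
      let C := cov_mx X in
      let gamma := submod_ratio Z X SOMP k in
      let lambda2k := sparse_lambda_min C (2 * k) in
      let lambdak := sparse_lambda_min C k in
      [/\ R2 Z X SOMP >= (1 - expR (- (gamma * lambda2k))) * OPT Z X k,
          (1 - expR (- (gamma * lambda2k))) * OPT Z X k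
            >= (1 - expR (- lambda2k ^+ 2)) * OPT Z X k &
          R2 Z X SOMP
            >= (1 - expR (- lambdak ^+ 2)) * theta lambdak * OPT Z X k].
Proof.
(* The factor [1 / 4] is that of [greedy_quarter_bound]; it serves as both constants of
   [Theta_on]. *)
exists (fun x => 4^-1 * 2^-1 `^ x^-1).
  by exists 4^-1, 4^-1; split; rewrite ?invr_gt0.
move=> d T P n k Z X SOMP /andP[k0 kn] EZ VZ EX VX uC [S_ [S0 step SkE]] SOMPk.
move=> C gamma lambda2k lambdak.
have psdC : psd C := psd_cov_mx EX VX.
have diagC := diag_cov_mx EX VX.
pose a S := incl_mx S *m reg_coef Z X S.
have aP S : normal_eq C (cov_vec Z X) S (a S) := normal_eq_reg (cov_vec Z X) (uC S).
have R2a S : R2 Z X S = explained C (cov_vec Z X) (a S) := R2E EZ VZ EX VX (aP S).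
have R2_mono (S S' : {set 'I_n}) : S \subset S' -> R2 Z X S <= R2 Z X S'.
  by rewrite !R2a; exact: gain_mono.
have greedy i : (i < k)%N -> greedy_step C (cov_vec Z X) a (S_ i) (S_ i.+1).
  move=> /step[m [mmax ->]]; exists m; split=> // j.
  by have := mmax j; rewrite !(cov_Res EZ VZ EX VX).
have [A Ak ->] := OPT_attained Z X kn.
have A0 : 0 <= R2 Z X A by rewrite R2a; exact: (gain_ge0 psdC aP).
pose i0 := Ordinal (leq_trans k0 kn).
have l2k0 : 0 <= lambda2k := sparse_lambda_min_ge0 (2 * k) psdC.
have l2k1 : lambda2k <= 1.
  by rewrite -(diagC i0) sparse_lambda_min_le// muln_gt0.
have lk0 : 0 <= lambdak := sparse_lambda_min_ge0 k psdC.
have lk1 : lambdak <= 1 by rewrite -(diagC i0) sparse_lambda_min_le.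
(* The upper bound on a joint gain meets the lower bounds on single gains. The union has at most
   [2 k] elements, as [L] lies in the output of size [k]. *)
have gamma_ge : lambda2k <= gamma.
  apply: (le_inf_ratios R2_mono) => // L S LS Sk; rewrite !R2a.
  apply: (le_trans (gain_le psdC aP _)).
    rewrite (leq_trans (leq_card_setU _ _))// mul2n -addnn leq_add//.
    by rewrite -SOMPk subset_leq_card.
  by apply: ler_sum => i _; rewrite !R2a; exact: gain_add_ge.
have gamma1 : gamma <= 1 := inf_ratios_le1 R2_mono SOMP k.
split.
- rewrite -SkE !R2a; apply: (greedy_ratio_bound psdC diagC aP k0 S0 greedy).
  + by rewrite Ak.
  + by rewrite gamma1 (le_trans l2k0).
  + move=> L S; rewrite SkE -!R2a => LS Sk SL.
    under eq_bigr do rewrite -!R2a.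
    exact: (inf_ratios_mul_le R2_mono).
- apply: ler_wpM2r => //; rewrite lerD2l lerN2 ler_expR lerN2 expr2.
  exact: ler_wpM2r.
- apply: (@le_trans _ _ (4^-1 * lambdak * R2 Z X A)); last first.
    by rewrite -SkE !R2a; exact: (greedy_quarter_bound psdC diagC aP k0 greedy).
  apply: ler_wpM2r => //; rewrite [leRHS]mulrC; apply: ler_pM.
  + by rewrite subr_ge0 expR_le1 oppr_le0 sqr_ge0.
  + by rewrite mulr_ge0 ?powR_ge0// invr_ge0.
  + rewrite (le_trans (one_sub_expRN_le _))// expr2 -[leRHS]mulr1.
    exact: ler_wpM2l.
  + rewrite -[leRHS]mulr1 ler_wpM2l ?invr_ge0//.
    (* A power of [1 / 2] with nonnegative exponent is at most 1; at [lambdak = 0] the inverse is 0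
       by convention. *)
    rewrite -[leRHS](powRr0 2^-1); apply: ger_powR; last by rewrite invr_ge0.
    by rewrite invr_gt0 invf_le1 ?ltr0n// ler1n.
Qed.
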